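(* If $C,D\subset\mathbb{P}^n$ are the binomial hypersurfaces $$C=Z(\alpha_1X^{I_1}-\alpha_2X^{I_2})\quad\text{and}\quad D=Z(\beta_1X^{I_1}-\beta_2X^{I_2}),$$ then $C\star D$ is the binomial hypersurface $$C\star D=Z(\alpha_1\beta_1X^{I_1}-\alpha_2\beta_2X^{I_2}).$$
   Context: We work over $\mathbb{C}$. For points $p=[a_0:\cdots:a_n]$ and $q=[b_0:\cdots:b_n]$ of $\mathbb{P}^n$ with $a_ib_i\neq 0$ for some $i$, put $p\star q=[a_0b_0:\cdots:a_nb_n]$; if $a_ib_i=0$ for all $i$, then $p\star q$ is not defined. For varieties $V,W\subset\mathbb{P}^n$, the Hadamard product $V\star W$ is the Zariski closure of $\{p\star q: p\in V,\ q\in W,\ p\star q \text{ is defined}\}$. For $I=(i_0,\dots,i_n)\in\mathbb{N}^{n+1}$, $X^I$ denotes the monomial $x_0^{i_0}\cdots x_n^{i_n}$. $Z(f)$ denotes the zero set of $f$ in $\mathbb{P}^n$. A binomial hypersurface is an irreducible hypersurface in $\mathbb{P}^n$ whose defining equation (generator of its homogeneous ideal) is of the form $\alpha_1X^{I_1}-\alpha_2X^{I_2}=0$, with $X^{I_1}\neq X^{I_2}$ of the same degree and $\alpha_1,\alpha_2\in\mathbb{C}$ nonzero. *)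

(* Defs.v *)
From HB Require Import structures.
From mathcomp Require Import all_boot all_order all_algebra.
From mathcomp Require Import generic_quotient.
From mathcomp Require Import boolp classical_sets reals.
From mathcomp Require Import complex mpoly.

Set Implicit Arguments.
Unset Strict Implicit.
Unset Printing Implicit Defensive.

Import GRing.Theory.
Local Open Scope ring_scope.
Local Open Scope quotient_scope.
Local Open Scope classical_set_scope.

Section ProjectiveSpace.
Variables (K : fieldType) (n : nat).

Record nzvec : Type :=
  NzVec { nzvec_val : 'rV[K]_n.+1; nzvec_neq0 : nzvec_val != 0 }.
HB.instance Definition _ := [isSub for nzvec_val].
HB.instance Definition _ := [Choice of nzvec by <:].

Definition proportional (v w : nzvec) : bool :=
  `[< exists2 c : K, c != 0 & val v = c *: val w >].

Lemma proportional_refl : reflexive proportional.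
Proof. by move=> v; apply/asboolP; exists 1; rewrite ?oner_eq0 ?scale1r. Qed.

Lemma proportional_sym : ssrbool.symmetric proportional.
Proof.
have H v w : proportional v w -> proportional w v.
  move=> /asboolP[c c0 e]; apply/asboolP; exists c^-1; first by rewrite invr_eq0.
  by rewrite e scalerA mulVf ?scale1r.
by move=> v w; apply/idP/idP; apply: H.
Qed.

Lemma proportional_trans : transitive proportional.
Proof.
move=> w v u /asboolP[c c0 ec] /asboolP[d d0 ed]; apply/asboolP.
by exists (c * d); rewrite ?mulf_neq0 // ec ed scalerA.
Qed.

Canonical proportional_equiv :=
  EquivRel proportional proportional_refl proportional_sym proportional_trans.

Definition projSpace : Type := {eq_quot proportional_equiv}.
HB.instance Definition _ := EqQuotient.on projSpace.

Definition proj_pt (v : nzvec) : projSpace := \pi_projSpace v.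

Lemma proj_ptP (v w : nzvec) :
  proj_pt v = proj_pt w <-> exists2 c : K, c != 0 & val v = c *: val w.
Proof.
split; first by move=> /eqmodP /asboolP.
by move=> h; apply/eqmodP/asboolP.
Qed.

Definition hadamard_mul (v w : 'rV[K]_n.+1) : 'rV[K]_n.+1 :=
  \row_i (v 0 i * w 0 i).

(* [None] when p * q is not defined; [hadamard_ptE] below shows that the result
   does not depend on the representatives. *)
Definition hadamard_pt (p q : projSpace) : option projSpace :=
  omap proj_pt (insub (hadamard_mul (val (repr p)) (val (repr q)))).

Lemma hadamard_ptE (v w : nzvec) :
  hadamard_pt (proj_pt v) (proj_pt w) =
  omap proj_pt (insub (hadamard_mul (val v) (val w))).
Proof.
rewrite /hadamard_pt.
have /proj_ptP[c c0 ->] : proj_pt (repr (proj_pt v)) = proj_pt v by exact: reprK.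
have /proj_ptP[d d0 ->] : proj_pt (repr (proj_pt w)) = proj_pt w by exact: reprK.
have -> : hadamard_mul (c *: val v) (d *: val w) =
          (c * d) *: hadamard_mul (val v) (val w).
  by apply/rowP => i; rewrite !mxE mulrACA.
have cd0 : c * d != 0 by rewrite mulf_neq0.
case: insubP => [x _ ex|]; case: insubP => [y _ ey|] //=.
- by congr Some; apply/proj_ptP; exists (c * d); rewrite // ex ey.
- move=> /negPn/eqP e.
  by move: (valP x); rewrite /= ex e scaler0 eqxx.
- move=> /negPn; rewrite scaler_eq0 (negPf cd0) /= => /eqP e.
  by move: (valP y); rewrite /= ey e eqxx.
Qed.

Definition homogeneous (f : {mpoly K[n.+1]}) : Prop :=
  exists d : nat, f \is d.-homog.

(* Vanishing is required on all homogeneous coordinates of p, so that it makes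
   sense for every f; for homogeneous f one representative is enough
   ([vanishesE]). *)
Definition vanishes (f : {mpoly K[n.+1]}) (p : projSpace) : Prop :=
  forall v : nzvec, proj_pt v = p -> f.@[val v 0] = 0.

Lemma vanishesE (f : {mpoly K[n.+1]}) (v : nzvec) :
  homogeneous f -> (vanishes f (proj_pt v) <-> f.@[val v 0] = 0).
Proof.
move=> [d hf]; split=> [|fv w /proj_ptP[c _ ->]]; first exact.
suff -> : f.@[(c *: val v) 0] = c ^+ d * f.@[val v 0] by rewrite fv mulr0.
rewrite !mevalE mulr_sumr; apply: eq_big_seq => m mf.
rewrite -(dhomogP _ _ _ hf m mf) /= mdegE mulrCA; congr (_ * _).
rewrite -prodrXr -big_split /=; apply: eq_bigr => i _.
by rewrite mxE exprMn.
Qed.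

Definition zero_set (f : {mpoly K[n.+1]}) : set projSpace :=
  [set p | vanishes f p].

Definition zariski_closed (V : set projSpace) : Prop :=
  exists2 F : set {mpoly K[n.+1]},
    F `<=` [set f | homogeneous f] & V = \bigcap_(f in F) zero_set f.

Definition zariski_closure (S : set projSpace) : set projSpace :=
  smallest zariski_closed S.

Definition zariski_irreducible (V : set projSpace) : Prop :=
  V !=set0 /\
  forall A B : set projSpace, zariski_closed A -> zariski_closed B ->
    V `<=` A `|` B -> V `<=` A \/ V `<=` B.

Definition hypersurface (V : set projSpace) : Prop :=
  exists (d : nat) (f : {mpoly K[n.+1]}),
    [/\ (0 < d)%N, f != 0, f \is d.-homog & V = zero_set f].

Definition hadamard_prod (V W : set projSpace) : set projSpace :=
  zariski_closure
    [set r | exists p q, [/\ V p, W q & hadamard_pt p q = Some r]].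

(* Since [vanishes f p] quantifies over all coordinates of p, over an infinite
   field this is the homogeneous ideal of V. *)
Definition vanishing_ideal (V : set projSpace) : set {mpoly K[n.+1]} :=
  [set f | V `<=` zero_set f].

Definition generates_ideal_of (f : {mpoly K[n.+1]}) (V : set projSpace) : Prop :=
  vanishing_ideal V = [set h * f | h in [set: {mpoly K[n.+1]}]].

Definition binomial_eq (a1 : K) (I1 : 'X_{1..n.+1}) (a2 : K)
    (I2 : 'X_{1..n.+1}) : {mpoly K[n.+1]} :=
  a1 *: 'X_[I1] - a2 *: 'X_[I2].

Definition binomial_hypersurface (a1 : K) (I1 : 'X_{1..n.+1}) (a2 : K)
    (I2 : 'X_{1..n.+1}) (V : set projSpace) : Prop :=
  [/\ [/\ a1 != 0, a2 != 0, I1 != I2 & mdeg I1 = mdeg I2],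
      hypersurface V,
      zariski_irreducible V &
      generates_ideal_of (binomial_eq a1 I1 a2 I2) V].

End ProjectiveSpace.

(* Main.v *)
Require Import Defs.
From HB Require Import structures.
From mathcomp Require Import all_boot all_order all_algebra.
From mathcomp Require Import boolp classical_sets reals.
From mathcomp Require Import complex mpoly.

Local Open Scope ring_scope.

(** Pick a point [t] of [D] with all coordinates nonzero.  Multiplication by [t]
    is a linear automorphism of projective space, and it maps [C] onto the zero
    set [E] of the product binomial.  Hence [E] is contained in the set of
    products [p * q], which is trivially contained in the closed set [E]; and
    irreducibility and the generator of the ideal are carried over from [C] to
    [E] by the automorphism. *)

Section Dilation.
Set Implicit Arguments.
Unset Strict Implicit.
Unset Printing Implicit Defensive.
Import GRing.Theory.
Local Open Scope classical_set_scope.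

Variables (K : fieldType) (n : nat).
Implicit Types (t : 'rV[K]_n.+1) (f : {mpoly K[n.+1]}) (v w : nzvec K n).
Implicit Types (p : projSpace K n) (V : set (projSpace K n)).

(** * Vectors without zero coordinates, acting by coordinatewise multiplication *)

Definition torus t : Prop := forall i, t 0 i != 0.

Definition torus_inv t : 'rV[K]_n.+1 := \row_i (t 0 i)^-1.

Lemma torus_invK : involutive torus_inv.
Proof. by move=> t; apply/rowP => i; rewrite !mxE invrK. Qed.

Lemma torus_torus_inv t : torus t -> torus (torus_inv t).
Proof. by move=> ht i; rewrite mxE invr_eq0. Qed.

Lemma torus_neq0 t : torus t -> t != 0.
Proof. by move=> ht; apply/eqP => t0; move: (ht 0); rewrite t0 mxE eqxx. Qed.

Lemma meval_torus_neq0 t (m : 'X_{1..n.+1}) : torus t -> 'X_[m].@[t 0] != 0.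
Proof.
by move=> ht; rewrite mevalX; apply/prodf_neq0 => i _; rewrite expf_neq0.
Qed.

Lemma meval_torus_inv t (m : 'X_{1..n.+1}) :
  'X_[m].@[torus_inv t 0] = ('X_[m].@[t 0])^-1.
Proof.
rewrite !mevalX -prodfV; apply: eq_bigr => i _.
by rewrite mxE exprVn.
Qed.

Lemma hadamard_mulC : commutative (@hadamard_mul K n).
Proof. by move=> v w; apply/rowP => i; rewrite !mxE mulrC. Qed.

Lemma hadamard_mulKV t v : torus t ->
  hadamard_mul (torus_inv t) (hadamard_mul t (val v)) = val v.
Proof. by move=> ht; apply/rowP => i; rewrite !mxE mulKf. Qed.

Lemma hadamard_mul_neq0 t v : torus t -> hadamard_mul t (val v) != 0.
Proof.
move=> ht; apply: contra_neq (valP v) => /rowP e; apply/rowP => i.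
by move: (e i); rewrite !mxE => /eqP; rewrite mulf_eq0 (negPf (ht i)) => /eqP.
Qed.

Lemma mevalX_hadamard (v w : 'rV[K]_n.+1) (m : 'X_{1..n.+1}) :
  'X_[m].@[hadamard_mul v w 0] = 'X_[m].@[v 0] * 'X_[m].@[w 0].
Proof.
rewrite !mevalX -big_split; apply: eq_bigr => i _.
by rewrite mxE exprMn.
Qed.

(** * Pullback of polynomials along a dilation *)

Definition dilate_poly t f : {mpoly K[n.+1]} :=
  f \mPo [tuple t 0 i *: 'X_i | i < n.+1].

Lemma dilate_polyX t (m : 'X_{1..n.+1}) :
  dilate_poly t 'X_[m] = 'X_[m].@[t 0] *: 'X_[m].
Proof.
rewrite /dilate_poly comp_mpolyX mevalX [X in _ *: X]mpolyXE_id -scaler_prod.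
by apply: eq_bigr => i _; rewrite tnth_mktuple exprZn.
Qed.

(** The substitution is diagonal in the monomial basis. Invertibility and preservation of
    homogeneity are then read off coefficient by coefficient. *)
Lemma mcoeff_dilate_poly t f (m : 'X_{1..n.+1}) :
  (dilate_poly t f)@_m = f@_m * 'X_[m].@[t 0].
Proof.
rewrite /dilate_poly comp_mpolyEX [X in _ = X@_m * _]mpolyE !raddf_sum mulr_suml.
apply: eq_bigr => k _ /=; rewrite -/(dilate_poly t _) dilate_polyX !mcoeffZ mcoeffX.
by case: eqP => [->|_]; rewrite ?mulr1 ?mulr0 // mul0r.
Qed.

Lemma meval_dilate_poly t f (v : 'rV[K]_n.+1) :
  (dilate_poly t f).@[v 0] = f.@[hadamard_mul t v 0].
Proof.
rewrite /dilate_poly comp_mpoly_meval; apply: meval_eq => i.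
by rewrite tnth_mktuple mevalZ mevalXU mxE.
Qed.

Lemma dilate_polyK t f : torus t ->
  dilate_poly t (dilate_poly (torus_inv t) f) = f.
Proof.
move=> ht; apply/mpolyP => m.
by rewrite !mcoeff_dilate_poly meval_torus_inv divfK // meval_torus_neq0.
Qed.

Lemma homogeneous_dilate_poly t f : homogeneous f -> homogeneous (dilate_poly t f).
Proof.
move=> [d /dhomogP hf]; exists d; apply/dhomogP => m; rewrite mcoeff_msupp.
rewrite mcoeff_dilate_poly => fm; apply: hf; rewrite mcoeff_msupp.
by apply: contra_neq fm => ->; rewrite mul0r.
Qed.

Lemma dilate_poly_binomial t a1 (I1 : 'X_{1..n.+1}) a2 I2 :
  dilate_poly t (binomial_eq a1 I1 a2 I2) =
  binomial_eq (a1 * 'X_[I1].@[t 0]) I1 (a2 * 'X_[I2].@[t 0]) I2.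
Proof.
rewrite /binomial_eq /dilate_poly comp_mpolyB !comp_mpolyZ.
by rewrite -!/(dilate_poly t _) !dilate_polyX !scalerA.
Qed.

(** * Dilations as automorphisms of projective space *)

Definition dilate t v : nzvec K n := insubd v (hadamard_mul t (val v)).

(** For [t] in the torus the product is nonzero, so the default [v] given to [insubd] is never
    returned. *)
Lemma val_dilate t v : torus t -> val (dilate t v) = hadamard_mul t (val v).
Proof. by move=> ht; rewrite insubdK //; exact: hadamard_mul_neq0. Qed.

Definition dilate_pt t p : projSpace K n := proj_pt (dilate t (repr p)).

Lemma proj_pt_repr p : proj_pt (repr p) = p.
Proof. exact: reprK. Qed.

Lemma dilate_ptE t v : torus t -> dilate_pt t (proj_pt v) = proj_pt (dilate t v).
Proof.
move=> ht; apply/proj_ptP.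
have /proj_ptP[c c0 e] := proj_pt_repr (proj_pt v).
exists c => //; rewrite !val_dilate // e.
by apply/rowP => i; rewrite !mxE mulrCA.
Qed.

Lemma dilate_ptK t : torus t -> cancel (dilate_pt t) (dilate_pt (torus_inv t)).
Proof.
move=> ht p; have hs := torus_torus_inv ht.
rewrite -[p]proj_pt_repr !dilate_ptE //; congr proj_pt; apply: val_inj.
by rewrite !val_dilate // hadamard_mulKV.
Qed.

Lemma dilate_ptVK t : torus t -> cancel (dilate_pt (torus_inv t)) (dilate_pt t).
Proof. by move=> /torus_torus_inv /dilate_ptK; rewrite torus_invK. Qed.

Lemma vanishes_dilate t f p : torus t ->
  vanishes f (dilate_pt t p) <-> vanishes (dilate_poly t f) p.
Proof.
move=> ht; split=> h v.
  move=> e; rewrite meval_dilate_poly -val_dilate //; apply: h.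
  by rewrite -dilate_ptE ?e.
(* Vanishing concerns every representative [v] of the dilated point; dilating [v] back by the
   inverse of [t] gives a representative of [p]. *)
move=> e; have hs := torus_torus_inv ht.
have := h (dilate (torus_inv t) v).
rewrite -dilate_ptE // e dilate_ptK // => /(_ erefl).
rewrite meval_dilate_poly val_dilate //.
by rewrite -{1}[t]torus_invK hadamard_mulKV.
Qed.

Lemma zero_set_dilate t f : torus t ->
  dilate_pt t @^-1` zero_set f = zero_set (dilate_poly t f).
Proof. by move=> ht; apply/seteqP; split=> p /=; apply vanishes_dilate. Qed.

Lemma zariski_closed_dilate t V : torus t ->
  zariski_closed V -> zariski_closed (dilate_pt t @^-1` V).
Proof.
move=> ht [F hF ->]; exists [set dilate_poly t f | f in F].
  by move=> _ [f Ff <-]; apply: homogeneous_dilate_poly; exact: hF.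
rewrite bigcap_image preimage_bigcap.
by apply: eq_bigcapr => f _; rewrite zero_set_dilate.
Qed.

Lemma zariski_irreducible_dilate t V : torus t ->
  zariski_irreducible V -> zariski_irreducible (dilate_pt t @^-1` V).
Proof.
move=> ht [[p Vp] irrV]; have hs := torus_torus_inv ht.
split; first by exists (dilate_pt (torus_inv t) p); rewrite /= dilate_ptVK.
move=> A B cA cB sAB.
(* A closed cover of the preimage is transported to a closed cover of [V] by the inverse
   dilation. *)
have sV : V `<=` dilate_pt (torus_inv t) @^-1` A `|` dilate_pt (torus_inv t) @^-1` B.
  by move=> q Vq; apply: sAB; rewrite /= dilate_ptVK.
have [] := irrV _ _ (zariski_closed_dilate hs cA) (zariski_closed_dilate hs cB) sV.
  by move=> sA; left=> q Vq; rewrite -[q](dilate_ptK ht); exact: sA.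
by move=> sB; right=> q Vq; rewrite -[q](dilate_ptK ht); exact: sB.
Qed.

(** Pulling [g] back by the inverse dilation lands in the ideal of [V], where it is a multiple
    [h * f]. Pulling back by [t], a ring morphism, recovers [g] as a multiple of the dilated [f]. *)
Lemma generates_ideal_of_dilate t f V : torus t ->
  generates_ideal_of f V ->
  generates_ideal_of (dilate_poly t f) (dilate_pt t @^-1` V).
Proof.
move=> ht gf; have hs := torus_torus_inv ht; apply/seteqP; split=> g.
  move=> hg; have : vanishing_ideal V (dilate_poly (torus_inv t) g).
    by move=> p Vp; apply/vanishes_dilate => //; apply: hg; rewrite /= dilate_ptVK.
  rewrite gf => -[h _ e]; exists (dilate_poly t h) => //.
  by rewrite -[RHS](dilate_polyK g ht) -e [RHS]rmorphM.
move=> [h _ <-] p Vp v e; rewrite mevalM.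
have : vanishing_ideal V f by rewrite gf; exists 1; rewrite ?mul1r.
by move=> /(_ _ Vp) /(vanishes_dilate _ _ ht) /(_ v e) ->; rewrite mulr0.
Qed.

(** * Rescaled equations and binomial equations *)

Lemma generates_ideal_ofZ c f V : c != 0 ->
  generates_ideal_of (c *: f) V -> generates_ideal_of f V.
Proof.
rewrite /generates_ideal_of => c0 ->; apply/seteqP; split=> _ [h _ <-].
  by exists (c *: h); rewrite // -scalerAl -scalerAr.
by exists (c^-1 *: h); rewrite // -scalerAl -scalerAr scalerA mulVf ?scale1r.
Qed.

Lemma zero_setZ c f : c != 0 -> zero_set (c *: f) = zero_set f.
Proof.
move=> c0; apply/seteqP; split=> p fp v e; move: (fp v e); rewrite mevalZ.
  by move=> /eqP; rewrite mulf_eq0 (negPf c0) => /eqP.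
by move=> ->; rewrite mulr0.
Qed.

Lemma hadamard_pt_dilate v p : torus (val v) ->
  hadamard_pt p (proj_pt v) = Some (dilate_pt (val v) p).
Proof.
move=> hv; rewrite -[p]proj_pt_repr hadamard_ptE dilate_ptE // hadamard_mulC.
by rewrite -val_dilate // valK.
Qed.

Lemma zariski_closed_zero_set f : homogeneous f -> zariski_closed (zero_set f).
Proof. by move=> hf; exists [set f] => [_ ->//|]; rewrite bigcap_set1. Qed.

Lemma dhomog_binomial_eq (a1 : K) (I1 : 'X_{1..n.+1}) a2 I2 : mdeg I1 = mdeg I2 ->
  binomial_eq a1 I1 a2 I2 \is (mdeg I1).-homog.
Proof.
by move=> e; rewrite rpredB // dhomogZ // dhomogX /= ?e.
Qed.

Lemma vanishes_binomial a1 (I1 : 'X_{1..n.+1}) a2 I2 v : mdeg I1 = mdeg I2 ->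
  vanishes (binomial_eq a1 I1 a2 I2) (proj_pt v) <->
  a1 * 'X_[I1].@[val v 0] = a2 * 'X_[I2].@[val v 0].
Proof.
move=> e; rewrite vanishesE; last by exists (mdeg I1); exact: dhomog_binomial_eq.
rewrite mevalB !mevalZ; split=> [/eqP|->]; last by rewrite subrr.
by rewrite subr_eq0 => /eqP.
Qed.

Lemma hypersurface_binomial (a1 : K) (I1 : 'X_{1..n.+1}) a2 I2 :
  a1 != 0 -> I1 != I2 -> mdeg I1 = mdeg I2 ->
  hypersurface (zero_set (binomial_eq a1 I1 a2 I2)).
Proof.
move=> a10 neI e; exists (mdeg I1), (binomial_eq a1 I1 a2 I2); split=> //.
(* In degree 0 both exponents would be zero, hence equal. *)
- rewrite lt0n; apply: contra_neq neI => d0.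
  by move: (e); rewrite d0 => /esym/eqP; move/eqP: d0; rewrite !mdeg_eq0 => /eqP-> /eqP.
(* The coefficient at [I1] is [a1], because the two monomials differ. *)
- apply: contraNneq a10 => /(congr1 (mcoeff I1)).
  by rewrite mcoeffB !mcoeffZ !mcoeffX eqxx eq_sym (negPf neI) mulr1 mulr0 subr0 mcoeff0 => ->.
- exact: dhomog_binomial_eq.
Qed.

End Dilation.

(** * Torus points on binomial hypersurfaces over an algebraically closed field *)

Lemma closed_field_root (F : closedFieldType) (k : nat) (a : F) :
  (0 < k)%N -> exists x, x ^+ k = a.
Proof.
case: k => // k _.
(* The right-hand side is the polynomial of degree below [k] whose only possibly nonzero coefficient
   is the constant [a]. *)
have [x e] := @GRing.solve_monicpoly F k.+1 (fun i => if i == 0%N then a else 0) isT.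
exists x; rewrite e big_ord_recl /= GRing.expr0 GRing.mulr1.
by rewrite big1 ?GRing.addr0 // => i _; rewrite GRing.mul0r.
Qed.

Section ClosedField.
Set Implicit Arguments.
Unset Strict Implicit.
Unset Printing Implicit Defensive.
Import GRing.Theory.
Local Open Scope classical_set_scope.

Variables (F : closedFieldType) (n : nat).

(** Choose a coordinate [i] where the exponents differ and set all other coordinates to 1. The
    binomial equation then involves one unknown, and extracting a root solves it. *)
Lemma exists_torus_binomial (a1 a2 : F) (I1 I2 : 'X_{1..n.+1}) :
  a1 != 0 -> a2 != 0 -> I1 != I2 ->
  exists2 t : 'rV[F]_n.+1, torus t &
    a1 * 'X_[I1].@[t 0] = a2 * 'X_[I2].@[t 0].
Proof.
(* Exchanging the two terms of the binomial makes the exponent difference at [i] positive. *)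
wlog [i lti] : a1 a2 I1 I2 / exists i, (I2 i < I1 i)%N.
  move=> H a10 a20 neI.
  have [i nei] : exists i, I1 i != I2 i.
    apply/existsP; apply: contraNT neI => /existsPn h.
    by apply/eqP/mnmP => i; apply/eqP/negPn/h.
  have [lt|gt|e] := ltngtP (I1 i) (I2 i); last by rewrite e eqxx in nei.
    have [||t ht tE] := H a2 a1 I2 I1 _ a20 a10; last by exists t.
      by exists i.
    by rewrite eq_sym.
  by apply: H => //; exists i.
move=> a10 a20 _.
have k0 : (0 < I1 i - I2 i)%N by rewrite subn_gt0.
have [x ex] := closed_field_root (a2 / a1) k0.
have x0 : x != 0.
  have : x ^+ (I1 i - I2 i) != 0 by rewrite ex mulf_neq0 ?invr_eq0.
  by rewrite expf_eq0 k0.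
pose t : 'rV[F]_n.+1 := \row_j (if j == i then x else 1).
have tE (m : 'X_{1..n.+1}) : 'X_[m].@[t 0] = x ^+ m i.
  rewrite mevalX (bigD1 i) //= mxE eqxx big1 ?mulr1 // => j /negPf ji.
  by rewrite mxE ji expr1n.
exists t; first by move=> j; rewrite mxE; case: ifP => _; rewrite ?oner_eq0.
by rewrite !tE -(subnK (ltnW lti)) exprD ex mulrA mulrCA divff ?mulr1.
Qed.

(** * The Hadamard product of two binomial hypersurfaces *)

Lemma hadamard_prod_binomial (I1 I2 : 'X_{1..n.+1}) (a1 a2 b1 b2 : F)
    (C D : set (projSpace F n)) :
  C = zero_set (binomial_eq a1 I1 a2 I2) ->
  binomial_hypersurface a1 I1 a2 I2 C ->
  D = zero_set (binomial_eq b1 I1 b2 I2) ->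
  b1 != 0 -> b2 != 0 ->
  hadamard_prod C D = zero_set (binomial_eq (a1 * b1) I1 (a2 * b2) I2) /\
  binomial_hypersurface (a1 * b1) I1 (a2 * b2) I2 (hadamard_prod C D).
Proof.
move=> eC [[a10 a20 neI dI] _ irrC genC] eD b10 b20.
set E := zero_set _.
have [t ht tD] := exists_torus_binomial b10 b20 neI.
have hs := torus_torus_inv ht.
(* The pullback of the equation of [C] has coefficients [a1] and [a2] divided by the values at [t]
   of the two monomials. Since [t] satisfies the equation of [D], the same [c] turns [a1 * b1] and
   [a2 * b2] into these coefficients. *)
pose c := (b1 * 'X_[I1].@[t 0])^-1.
have c0 : c != 0 by rewrite invr_eq0 mulf_neq0 // meval_torus_neq0.
have dilC : dilate_poly (torus_inv t) (binomial_eq a1 I1 a2 I2) =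
    c *: binomial_eq (a1 * b1) I1 (a2 * b2) I2.
  rewrite dilate_poly_binomial !meval_torus_inv /binomial_eq scalerBr !scalerA.
  have inv_cancel (a b x : F) : b != 0 -> a / x = (b * x)^-1 * (a * b).
    by move=> b0; rewrite [a * b]mulrC mulrA invfM (mulrAC b^-1) mulVf // mul1r mulrC.
  by congr (_ *: _ - _ *: _); rewrite /c; [|rewrite tD]; apply: inv_cancel.
have EC : E = dilate_pt (torus_inv t) @^-1` C.
  by rewrite eC zero_set_dilate // dilC zero_setZ.
have prodE : hadamard_prod C D = E.
  apply/seteqP; split.
    (* By minimality of the closure it suffices that [E] is closed and contains all products; the
       latter follows by multiplying the two binomial equations. *)
    apply: smallest_sub.
      apply: zariski_closed_zero_set; exists (mdeg I1).
      exact: dhomog_binomial_eq.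
    move=> r [p [q [Cp Dq]]].
    move: Cp Dq; rewrite -[p]proj_pt_repr -[q]proj_pt_repr eC eD /=.
    move=> /(vanishes_binomial _ _ _ dI) ev /(vanishes_binomial _ _ _ dI) ew.
    rewrite hadamard_ptE; case: insubP => // u _ eu [<-].
    apply/vanishes_binomial => //.
    by rewrite [val u]eu !mevalX_hadamard mulrACA ev ew mulrACA.
  (* A point [r] of [E] is the product of its dilate by the inverse of [t], which lies in [C], and
     the point [t] of [D]. *)
  move=> r; rewrite EC => Cr; apply: sub_gen_smallest.
  pose w : nzvec F n := Sub t (torus_neq0 ht).
  exists (dilate_pt (torus_inv t) r), (proj_pt w); split=> //.
    by rewrite eD; apply/vanishes_binomial.
  by rewrite hadamard_pt_dilate // SubK dilate_ptVK.
split=> //; rewrite prodE; split; first by split=> //; apply: mulf_neq0.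
- by apply: hypersurface_binomial => //; apply: mulf_neq0.
- by rewrite EC; apply: zariski_irreducible_dilate.
(* The dilated generator is [c] times the product binomial, and a nonzero scalar does not change the
   ideal. *)
apply: (generates_ideal_ofZ c0).
by rewrite -dilC EC; apply: generates_ideal_of_dilate.
Qed.

End ClosedField.

Theorem proposition4p5 (R : realType) (n : nat) (I1 I2 : 'X_{1..n.+1})
    (alpha1 alpha2 beta1 beta2 : R[i]) (C D : set (projSpace R[i] n)) :
  C = zero_set (binomial_eq alpha1 I1 alpha2 I2) ->
  binomial_hypersurface alpha1 I1 alpha2 I2 C ->
  D = zero_set (binomial_eq beta1 I1 beta2 I2) ->
  binomial_hypersurface beta1 I1 beta2 I2 D ->
  hadamard_prod C D =
    zero_set (binomial_eq (alpha1 * beta1) I1 (alpha2 * beta2) I2) /\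
  binomial_hypersurface (alpha1 * beta1) I1 (alpha2 * beta2) I2
    (hadamard_prod C D).
Proof.
move=> eC hC eD [[b10 b20 _ _] _ _ _].
exact: (@hadamard_prod_binomial R[i]).
Qed.
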